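(* Let $Q\subset\mathbb{R}^d$ be compact and convex, with $D>0$ such that $\|x-y\|\le D$ for all $x,y\in Q$, and let $f$ be $L$-smooth on $Q$, i.e. $L>0$ and $\|\nabla f(x)-\nabla f(y)\|\le L\|x-y\|$ for all $x,y\in Q$. For $x^k,h^k$ generated by the deterministic algorithm FW via JAGUAR (see context) one can take $\gamma_k=\frac{4}{k+8d}$; then $$\mathbb{E}\big[\|h^k-\nabla f(x^k)\|^2\big]=\mathcal{O}\left(\|\widetilde\nabla f_\delta(x^k)-\nabla f(x^k)\|^2+\frac{d^2L^2D^2}{(k+8d)^2}\right).$$
   Context: $\|\cdot\|$ is the Euclidean norm on $\mathbb{R}^d$ and $e_1,\dots,e_d$ the standard basis; $\mathcal{O}(\cdot)$ hides an absolute constant. The problem is $\min_{x\in Q}f(x)$ with $f$ differentiable; only a zero-order oracle returning the noisy values $f_\delta(x):=f(x)+\delta(x)$ is available, where $\delta$ is the oracle noise. For a smoothing parameter $\tau>0$ the full approximation of the gradient is $\widetilde\nabla f_\delta(x):=\sum_{i=1}^d\frac{f_\delta(x+\tau e_i)-f_\delta(x-\tau e_i)}{2\tau}e_i$. Deterministic algorithm FW via JAGUAR: start from $x^0\in Q$, $h^0=\widetilde\nabla f_\delta(x^0)$. For $k=0,1,2,\dots$: sample $i_k$ uniformly from $\{1,\dots,d\}$, independently; set $h^{k+1}=h^k-\langle h^k,e_{i_k}\rangle e_{i_k}+\frac{f_\delta(x^k+\tau e_{i_k})-f_\delta(x^k-\tau e_{i_k})}{2\tau}e_{i_k}$; choose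 $s^k\in\arg\min_{s\in Q}\langle s,h^{k+1}\rangle$; set $x^{k+1}=x^k+\gamma_k(s^k-x^k)$. The expectation is over the random indices.
   Formalization: The error term at x^k alone makes the claim false (h^k is built from queries at earlier iterates) and is random; it is replaced by the maximum over j ≤ k of the expected squared error of the gradient approximation at x^j, E‖∇̃f_δ(x^j) − ∇f(x^j)‖². *)

(* Defs.v *)
From mathcomp Require Import all_boot all_order all_algebra.
From mathcomp Require Import finmap.
From mathcomp Require Import all_classical all_reals all_analysis.

Set Implicit Arguments.
Unset Strict Implicit.
Unset Printing Implicit Defensive.

Import Order.TTheory GRing.Theory Num.Theory.
Import numFieldNormedType.Exports.

Local Open Scope classical_set_scope.
Local Open Scope ring_scope.

(* The library norm `|x| on 'rV[R]_d is the sup norm, hence these two. *)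
Definition dotp (R : realType) (d : nat) (u v : 'rV[R]_d) : R :=
  \sum_(i < d) u 0 i * v 0 i.

Definition enorm (R : realType) (d : nat) (u : 'rV[R]_d) : R :=
  Num.sqrt (\sum_(i < d) u 0 i ^+ 2).

Definition basis_vec (R : realType) (d : nat) (i : 'I_d) : 'rV[R]_d :=
  delta_mx 0 i.
Arguments basis_vec {R d} i.

Definition grad (R : realType) (d : nat) (f : 'rV[R]_d -> R) (x : 'rV[R]_d) :
    'rV[R]_d :=
  \row_(i < d) 'D_(basis_vec i) f x.

Definition lipschitz_grad_on (R : realType) (d : nat) (Q : set 'rV[R]_d)
    (f : 'rV[R]_d -> R) (L : R) : Prop :=
  forall x y, Q x -> Q y ->
    enorm (grad f x - grad f y) <= L * enorm (x - y).

Definition noisy (R : realType) (d : nat) (f delta : 'rV[R]_d -> R) :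
    'rV[R]_d -> R :=
  fun x => f x + delta x.

Definition central_diff (R : realType) (d : nat) (g : 'rV[R]_d -> R) (tau : R)
    (x : 'rV[R]_d) (i : 'I_d) : R :=
  (g (x + tau *: basis_vec i) - g (x - tau *: basis_vec i)) / (2 * tau).

Definition grad_approx (R : realType) (d : nat) (g : 'rV[R]_d -> R) (tau : R)
    (x : 'rV[R]_d) : 'rV[R]_d :=
  \sum_(i < d) central_diff g tau x i *: basis_vec i.

Definition linear_argmin (R : realType) (d : nat) (Q : set 'rV[R]_d)
    (h : 'rV[R]_d) : set 'rV[R]_d :=
  [set s | Q s /\ forall z, Q z -> dotp s h <= dotp z h].

Record iid_uniform_indices (R : realType) (disp : measure_display)
    (T : measurableType disp) (P : probability T R) (d : nat)
    (i : nat -> T -> 'I_d) : Prop := IidUniformIndices {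
  indices_measurable : forall k c, measurable (i k @^-1` [set c]) ;
  indices_uniform : forall k c, P (i k @^-1` [set c]) = (d%:R^-1)%:E ;
  indices_independent : forall (J : {fset nat}) (B : nat -> set 'I_d),
    P (\bigcap_(k in [set` J]) (i k @^-1` B k)) =
    (\prod_(k <- J) P (i k @^-1` B k))%E }.

(* [g] is the zero-order oracle. The choice of [s k] in the argmin is an
   arbitrary function of the indices drawn so far ([fw_s_adapted]); in
   particular it may be any fixed selection applied to [h k.+1], but it cannot
   anticipate the indices still to be drawn. *)
Record fw_jaguar (R : realType) (d : nat) (Q : set 'rV[R]_d)
    (g : 'rV[R]_d -> R) (tau : R) (gamma : nat -> R) (x0 : 'rV[R]_d)
    (T : Type) (i : nat -> T -> 'I_d) (x h s : nat -> T -> 'rV[R]_d) : Prop :=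
  FwJaguar {
  fw_x0 : forall w, x 0%N w = x0 ;
  fw_h0 : forall w, h 0%N w = grad_approx g tau x0 ;
  fw_hS : forall k w, h k.+1 w =
    h k w - dotp (h k w) (basis_vec (i k w)) *: basis_vec (i k w)
    + central_diff g tau (x k w) (i k w) *: basis_vec (i k w) ;
  fw_s : forall k w, linear_argmin Q (h k.+1 w) (s k w) ;
  fw_s_adapted : forall k w w',
    (forall j, (j <= k)%N -> i j w = i j w') -> s k w = s k w' ;
  fw_xS : forall k w, x k.+1 w = x k w + gamma k *: (s k w - x k w) }.

(* Main.v *)
(* Write g_k for the gradient of f at x^k and a_k for its finite-difference
   approximation there. Before the k-th draw, x^k and h^k are functions of the
   earlier indices, so they take finitely many values and are independent of
   i_k; refreshing one uniform coordinate thus gives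
     E |h^(k+1) - g_k|^2 = (1 - 1/d) E |h^k - g_k|^2 + (1/d) E |a_k - g_k|^2.
   Replacing g_k by g_(k+1) costs at most L D gamma_k in norm, and Young's
   inequality with parameter 1/(2d) keeps a contraction factor 1 - 1/(2d).
   The claim follows by induction on k with the constant 192. *)
Require Import Defs.
From mathcomp Require Import all_boot all_order all_algebra.
From mathcomp Require Import finmap ring lra.
From mathcomp Require Import all_classical all_reals all_analysis.

Set Implicit Arguments.
Unset Strict Implicit.
Unset Printing Implicit Defensive.

Import Order.TTheory GRing.Theory Num.Theory.
Import numFieldNormedType.Exports.

Local Open Scope classical_set_scope.
Local Open Scope ring_scope.

(** * Finite sums under the integral, functions of finitely many draws, the Euclidean norm *)

Lemma Rintegral_sum (disp : measure_display) (T : measurableType disp)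
    (R : realType) (mu : {measure set T -> \bar R}) (I : Type) (r : seq I)
    (F : I -> T -> R) :
  (forall c, mu.-integrable setT (EFin \o F c)) ->
  \int[mu]_w (\sum_(c <- r) F c w) = \sum_(c <- r) \int[mu]_w F c w.
Proof.
move=> iF; elim: r => [|c r IHr].
  under eq_Rintegral do rewrite big_nil.
  by rewrite Rintegral_cst// mul0r big_nil.
under eq_Rintegral do rewrite big_cons.
rewrite RintegralD//; first by rewrite IHr big_cons.
rewrite [X in mu.-integrable _ X](_ : _ =
    fun w => (\sum_(j <- r) (EFin \o F j) w)%E); first exact: integrable_sum.
by apply/funext => w /=; rewrite sumEFin.
Qed.

(** Adaptedness to the draws before the [k]-th, in pointwise form: only finitely many prefixes
    exist, so measurability follows from that of the draws, without a generated sigma-algebra. *)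
Definition depends_on_first (T A V : Type) (i : nat -> T -> A) (k : nat)
    (Y : T -> V) : Prop :=
  forall w w', (forall j, (j < k)%N -> i j w = i j w') -> Y w = Y w'.

Definition index_prefix (T A : Type) (i : nat -> T -> A) (k : nat) (w : T) :
  {ffun 'I_k -> A} := [ffun j : 'I_k => i j w].

(** [Y] is constant on each of the finitely many prefix events, hence a combination of their
    indicators; its expectation then reduces to probabilities of prefixes. *)
Lemma depends_on_first_indic (T : Type) (A : finType) (R : realType)
    (i : nat -> T -> A) (k : nat) (Y : T -> R) :
  depends_on_first i k Y ->
  exists F : {ffun 'I_k -> A} -> R,
    Y = fun w => \sum_c F c * \1_(index_prefix i k @^-1` [set c]) w.
Proof.
move=> dY.
have FP c : exists r, forall w, index_prefix i k w = c -> Y w = r.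
  have [[w wc]|nw] := pselect (exists w, index_prefix i k w = c).
    exists (Y w) => w' w'c; apply: dY => j jk.
    by have /ffunP/(_ (Ordinal jk)) := etrans w'c (esym wc); rewrite !ffunE.
  by exists 0 => w wc; case: nw; exists w.
have [F FE] := choice FP; exists F; apply/funext => w.
rewrite (bigD1 (index_prefix i k w))//= big1 ?addr0.
  by rewrite indicE mem_set// mulr1; exact: FE.
move=> c cw; rewrite indicE memNset ?mulr0//= => wc.
by rewrite wc eqxx in cw.
Qed.

Lemma enorm_sqr (R : realType) (d : nat) (u : 'rV[R]_d) :
  enorm u ^+ 2 = \sum_c u 0 c ^+ 2.
Proof. by rewrite sqr_sqrtr// sumr_ge0// => c _; rewrite sqr_ge0. Qed.

(** Young's inequality: in each coordinate the right side minus the left is t (u - v / t)^2. *)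
Lemma enorm_sqr_addr_le (R : realType) (d : nat) (u v : 'rV[R]_d) (t : R) :
  0 < t ->
  enorm (u + v) ^+ 2 <= (1 + t) * enorm u ^+ 2 + (1 + t^-1) * enorm v ^+ 2.
Proof.
move=> t0; rewrite !enorm_sqr !mulr_sumr -big_split/=.
apply: ler_sum => c _; rewrite mxE -subr_ge0.
have -> : (1 + t) * u 0 c ^+ 2 + (1 + t^-1) * v 0 c ^+ 2 - (u 0 c + v 0 c) ^+ 2
    = t * (u 0 c - t^-1 * v 0 c) ^+ 2 by field; rewrite gt_eqF.
by rewrite mulr_ge0 ?sqr_ge0// ltW.
Qed.

Lemma enormZ (R : realType) (d : nat) (t : R) (u : 'rV[R]_d) :
  enorm (t *: u) = `|t| * enorm u.
Proof.
rewrite -sqrtr_sqr -sqrtrM ?sqr_ge0// mulr_sumr; congr Num.sqrt.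
by apply: eq_bigr => c _; rewrite mxE exprMn.
Qed.

(** * Independence of the next draw and the refresh of one coordinate *)

Section iid_indices.
Context (R : realType) (disp : measure_display) (T : measurableType disp)
  (P : probability T R) (d : nat) (i : nat -> T -> 'I_d)
  (iidP : iid_uniform_indices P i).

Let mi k (B : set 'I_d) : measurable (i k @^-1` B).
Proof.
rewrite [X in measurable X](_ : _ = \bigcup_(c in B) (i k @^-1` [set c])).
  by apply: fin_bigcup_measurable => // c _; exact: indices_measurable iidP k c.
by apply/seteqP; split => w /= => [Bw|[c Bc /= ->]//]; exists (i k w).
Qed.

(** Puts a prefix event in the product form of [indices_independent]; the guard [val m = j] turns
    constraints indexed by ['I_k] into constraints indexed by all naturals. *)
Let prefix_bigcap k (c : {ffun 'I_k -> 'I_d}) :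
  index_prefix i k @^-1` [set c] =
  \bigcap_(j in [set` [fset j | j in iota 0 k]%fset])
    (i j @^-1` [set a | forall m : 'I_k, val m = j -> a = c m]).
Proof.
apply/seteqP; split => w /=.
  by move=> <- j _ m mj /=; rewrite ffunE mj.
move=> wc; apply/ffunP => m; rewrite ffunE; apply: (wc m) => //=.
by rewrite !inE /= mem_iota /=.
Qed.

Lemma measurable_prefix k (c : {ffun 'I_k -> 'I_d}) :
  measurable (index_prefix i k @^-1` [set c]).
Proof. by rewrite prefix_bigcap; exact: bigcap_measurableType. Qed.

Lemma probability_prefix_next k (c : {ffun 'I_k -> 'I_d}) (a : 'I_d) :
  P (index_prefix i k @^-1` [set c] `&` i k @^-1` [set a]) =
  ((d%:R^-1)%:E * P (index_prefix i k @^-1` [set c]))%E.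
Proof.
rewrite prefix_bigcap; set J := [fset j | j in iota 0 k]%fset.
pose B j := [set b | forall m : 'I_k, val m = j -> b = c m].
(* The time [k] lies outside [J], so adding its constraint to the product splits off exactly one
   factor 1/d. *)
pose B' j := if j == k then [set a] else B j.
have jNk j : j \in J -> (j == k) = false.
  by rewrite !inE /= mem_iota /= add0n => jk; rewrite ltn_eqF.
have -> : \bigcap_(j in [set` J]) (i j @^-1` B j) `&` i k @^-1` [set a] =
    \bigcap_(j in [set` (k |` J)%fset]) (i j @^-1` B' j).
  rewrite bigcap_fsetU1 /B' eqxx setIC; congr (_ `&` _).
  by apply: eq_bigcapr => j /= /jNk ->.
rewrite !(indices_independent iidP) big_fsetU1/=; last first.
  by apply/negP => /jNk; rewrite eqxx.
rewrite /B' eqxx (indices_uniform iidP); congr (_ * _)%E.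
by apply: eq_big_seq => j /jNk ->.
Qed.

Let integrable_scaled_indic (A : set T) (r : R) : measurable A ->
  P.-integrable setT (EFin \o (fun w => r * \1_A w)).
Proof.
move=> mA; rewrite [X in P.-integrable _ X](_ : _ =
    (fun w => r%:E * (\1_A w)%:E)%E).
  by apply: integrableZl => //; exact: integrable_indic.
by apply/funext => w /=; rewrite EFinM.
Qed.

Let Rintegral_scaled_indic (A : set T) (r : R) : measurable A ->
  \int[P]_w (r * \1_A w) = r * fine (P A).
Proof.
move=> mA; rewrite RintegralZl//; last exact: integrable_indic.
by rewrite /Rintegral integral_indic// setIT.
Qed.

Lemma integrable_depends_on_first k (Y : T -> R) :
  depends_on_first i k Y -> P.-integrable setT (EFin \o Y).
Proof.
move=> /depends_on_first_indic[F ->].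
rewrite [X in P.-integrable _ X](_ : _ = fun w =>
    (\sum_c (EFin \o (fun w => F c *
        \1_(index_prefix i k @^-1` [set c]) w)%R) w)%E).
  apply: integrable_sum => // c _.
  exact/integrable_scaled_indic/measurable_prefix.
by apply/funext => w /=; rewrite sumEFin.
Qed.

(** By linearity it is enough to treat indicators of prefix events, where [probability_prefix_next]
    applies. *)
Lemma Rintegral_next_index k (Y : T -> R) (a : 'I_d) :
  depends_on_first i k Y ->
  \int[P]_w (Y w * \1_(i k @^-1` [set a]) w) = d%:R^-1 * \int[P]_w Y w.
Proof.
move=> /depends_on_first_indic[F ->].
have mprefix := measurable_prefix.
have indicM (A B : set T) w : \1_A w * \1_B w = \1_(A `&` B) w :> R.
  by rewrite indicI.
under eq_Rintegral do rewrite mulr_suml.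
under eq_Rintegral do under eq_bigr do rewrite -mulrA indicM.
rewrite !Rintegral_sum; last 2 first.
- by move=> c; exact: integrable_scaled_indic.
- by move=> c; apply: integrable_scaled_indic; exact: measurableI.
rewrite mulr_sumr; apply: eq_bigr => c _.
rewrite !Rintegral_scaled_indic//; last exact: measurableI.
rewrite mulrCA; congr (_ * _).
by rewrite (probability_prefix_next c a) fineM// fin_num_measure.
Qed.

(** The mixed vector differs from [u] at most in the drawn coordinate. Each coordinate is drawn with
    probability 1/d independently of [u] and [v], and the expected changes are summed. *)
Lemma Rintegral_resampled_coordinate k (u v : T -> 'rV[R]_d) :
  depends_on_first i k u -> depends_on_first i k v ->
  \int[P]_w (enorm (\row_c (if c == i k w then v w 0 c else u w 0 c)) ^+ 2) =
  (1 - d%:R^-1) * \int[P]_w (enorm (u w) ^+ 2)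
  + d%:R^-1 * \int[P]_w (enorm (v w) ^+ 2).
Proof.
move=> du dv.
have dsq (z : T -> 'rV[R]_d) c : depends_on_first i k z ->
    depends_on_first i k (fun w => z w 0 c ^+ 2).
  by move=> dz w w' ww'; rewrite (dz w w').
have isq (z : T -> 'rV[R]_d) c : depends_on_first i k z ->
    P.-integrable setT (EFin \o (fun w => z w 0 c ^+ 2)).
  by move=> dz; exact: integrable_depends_on_first (dsq z c dz).
pose jump c w := (v w 0 c ^+ 2 - u w 0 c ^+ 2) * \1_(i k @^-1` [set c]) w.
have ijump c : P.-integrable setT (EFin \o jump c).
  (* [jump c] looks at the draw [k] itself, hence the level [k.+1]. *)
  apply: (@integrable_depends_on_first k.+1) => w w' ww'.
  rewrite /jump !indicE (dv w w') ?(du w w'); last 2 first.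
  - by move=> j jk; apply: ww'; exact: ltnW.
  - by move=> j jk; apply: ww'; exact: ltnW.
  by congr (_ * (nat_of_bool _)%:R); apply/idP/idP;
    rewrite !inE /= (ww' k (ltnSn k)).
transitivity (\int[P]_w (\sum_c (u w 0 c ^+ 2 + jump c w))).
  apply: eq_Rintegral => w _; rewrite enorm_sqr; apply: eq_bigr => c _.
  rewrite mxE /jump indicE; case: eqVneq => [->|cN].
    by rewrite mem_set// mulr1 addrC subrK.
  by rewrite memNset ?mulr0 ?addr0//= => cE; rewrite cE eqxx in cN.
rewrite Rintegral_sum; last first.
  move=> c; rewrite [X in P.-integrable _ X](_ : _ =
      ((EFin \o (fun w => (u w 0 c ^+ 2)%R)) \+ (EFin \o jump c))%E)//.
  by apply: integrableD => //; exact: isq.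
have ssq (z : T -> 'rV[R]_d) : depends_on_first i k z ->
    \int[P]_w (enorm (z w) ^+ 2) = \sum_c \int[P]_w (z w 0 c ^+ 2).
  move=> dz; under eq_Rintegral do rewrite enorm_sqr.
  by rewrite Rintegral_sum// => c; exact: isq.
rewrite !ssq// !mulr_sumr -big_split/=; apply: eq_bigr => c _.
rewrite RintegralD//; last exact: isq.
rewrite (Rintegral_next_index (k := k)); last first.
  by move=> w w' ww'; rewrite (dv w w')// (du w w').
by rewrite RintegralB//; [ring|exact: isq|exact: isq].
Qed.

End iid_indices.

(** * Convex steps, coordinates and the scalar recursion *)

Lemma convex_combinationP (R : realType) (d : nat) (Q : set 'rV[R]_d)
    (x s : 'rV[R]_d) (t : R) :
  @convex_set R 'rV[R]_d Q -> Q x -> Q s -> 0 <= t <= 1 ->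
  Q (x + t *: (s - x)).
Proof.
move=> cQ Qx Qs /andP[t0 t1].
have := cQ s x (Itv01 t0 t1) (mem_set Qs) (mem_set Qx).
move/set_mem; rewrite /conv/= /unstable.onem.
by rewrite scalerBl scale1r scalerBr addrCA addrA.
Qed.

Lemma grad_approxE (R : realType) (d : nat) (g : 'rV[R]_d -> R) (tau : R)
    (x : 'rV[R]_d) (c : 'I_d) :
  grad_approx g tau x 0 c = central_diff g tau x c.
Proof.
rewrite summxE (bigD1 c)//= !mxE !eqxx mulr1 big1 ?addr0// => j jc.
by rewrite !mxE eqxx eq_sym (negPf jc) mulr0.
Qed.

Lemma dotp_basis_vec (R : realType) (d : nat) (u : 'rV[R]_d) (c : 'I_d) :
  dotp u (basis_vec c) = u 0 c.
Proof.
rewrite /dotp (bigD1 c)//= !mxE !eqxx mulr1 big1 ?addr0// => j jc.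
by rewrite !mxE eqxx (negPf jc) mulr0.
Qed.

(* With q = 1/d, n = k + 8 d and W = d^2 B / n^2, the drift term is
   16 (q^2 + 2 q) W <= 48 q W. The contraction 1 - q/2 leaves a factor q/4 to
   absorb it, the other q/4 being spent on (1 - q/4) / n^2 <= 1 / (n + 1)^2;
   hence the constant 192 = 4 * 48. *)
Lemma jaguar_recursion (R : realFieldType) (d k : nat) (B H S M : R) :
  (0 < d)%N -> 0 <= B -> 0 <= S -> S <= M ->
  H <= 192 * (M + d%:R ^+ 2 * B / (k + 8 * d)%:R ^+ 2) ->
  (1 + (2 * d%:R)^-1) * ((1 - d%:R^-1) * H + d%:R^-1 * S)
    + (1 + 2 * d%:R) * (B * (4 / (k + 8 * d)%:R) ^+ 2)
  <= 192 * (M + d%:R ^+ 2 * B / (k.+1 + 8 * d)%:R ^+ 2).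
Proof.
move=> d_gt0 B0 S0 SM HM.
have natE m : (m + 8 * d)%:R = m%:R + 8 * d%:R :> R by rewrite natrD natrM.
have natSE : (k.+1 + 8 * d)%:R = k%:R + 8 * d%:R + 1 :> R.
  by rewrite addSn -natr1 natE.
rewrite natSE !natE in HM *.
have D1 : 1 <= d%:R :> R by rewrite ler1n.
have K0 : 0 <= k%:R :> R by [].
set e : R := d%:R in D1 HM *; set n := k%:R + 8 * e in HM *.
have e0 : 0 < e by lra.
have nge : 8 * e <= n by rewrite /n; lra.
have n0 : 0 < n by lra.
have M0 : 0 <= M by lra.
pose q := e^-1; have qe : q * e = 1 by rewrite mulVf ?gt_eqF.
have q0 : 0 < q by rewrite invr_gt0.
have q1 : q <= 1 by rewrite -qe ler_peMr// ltW.
rewrite invfM -/q.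
pose W := e ^+ 2 * B / n ^+ 2; pose W' := e ^+ 2 * B / (n + 1) ^+ 2.
have W0 : 0 <= W by rewrite /W divr_ge0 ?mulr_ge0 ?exprn_ge0// ltW.
have -> : (1 + 2 * e) * (B * (4 / n) ^+ 2) = (q ^+ 2 + 2 * q) * (16 * W).
  by rewrite /W /q; field; rewrite !gt_eqF.
have WW' : (1 - q / 4) * W <= W'.
  have -> : W' = W * (n ^+ 2 / (n + 1) ^+ 2).
    by rewrite /W /W'; field; rewrite !gt_eqF//; lra.
  rewrite mulrC ler_wpM2l// ler_pdivlMr ?exprn_gt0//; last by lra.
  (* Since n >= 8 d, q n (n + 1) >= 8 (n + 1), and a quarter of this exceeds 2 n + 1 = (n + 1)^2 -
     n^2. The shift 8 d in the step size serves this purpose. *)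
  have : q * (8 * e) * (n + 1) <= q * n * (n + 1).
    by apply: ler_wpM2r; [lra|apply: ler_wpM2l => //; lra].
  rewrite mulrCA qe mulr1 => qn.
  have qn0 : 0 <= q * (n + 1) by apply: mulr_ge0; lra.
  nra.
rewrite -/W -/W' in HM *.
have step1 : (1 - q) * H + q * S <= (1 - q) * (192 * (M + W)) + q * M.
  by apply: lerD; apply: ler_wpM2l => //; lra.
have step2 : (1 + 2^-1 * q) * ((1 - q) * H + q * S) <=
    (1 + 2^-1 * q) * ((1 - q) * (192 * (M + W)) + q * M).
  by apply: ler_wpM2l => //; lra.
have qM : 0 <= q * M by rewrite mulr_ge0// ltW.
have qW : 0 <= q * W by rewrite mulr_ge0// ltW.
have q2M : 0 <= q ^+ 2 * M by rewrite mulr_ge0 ?sqr_ge0.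
have q2W : 0 <= q ^+ 2 * W by rewrite mulr_ge0 ?sqr_ge0.
apply: (le_trans (lerD step2 (lexx _))).
(* Passing from [W] to [W'] costs at most 192 / 4 = 48 times [q * W], which the coefficient -64
   covers; the other corrections have the right sign. *)
have -> : (1 + 2^-1 * q) * ((1 - q) * (192 * (M + W)) + q * M)
    + (q ^+ 2 + 2 * q) * (16 * W) =
  192 * M - 95 * (q * M) - (95 + 2^-1) * (q ^+ 2 * M)
  + 192 * W - 64 * (q * W) - 80 * (q ^+ 2 * W) by field.
lra.
Qed.

(** * Iterates: dependence on the draws, feasibility, drift of the gradient *)

Section jaguar_iterates.
Context (R : realType) (d : nat) (Q : set 'rV[R]_d) (g : 'rV[R]_d -> R)
  (tau : R) (gamma : nat -> R) (x0 : 'rV[R]_d) (T : Type)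
  (i : nat -> T -> 'I_d) (x h s : nat -> T -> 'rV[R]_d)
  (fwP : fw_jaguar Q g tau gamma x0 i x h s).

(** The induction is joint because [h k.+1] reads [x k]. For [x k.+1], [fw_s_adapted] ensures that
    the choice of [s k] uses no draw after the [k]-th. *)
Lemma fw_iterates_depend k :
  depends_on_first i k (x k) /\ depends_on_first i k (h k).
Proof.
elim: k => [|k [dx dh]].
  by split=> w w' _; rewrite ?(fw_x0 fwP) ?(fw_h0 fwP).
split=> w w' ww'.
  rewrite !(fw_xS fwP) (dx w w') ?(fw_s_adapted fwP (k := k) (w' := w'))//.
  by move=> j jk; apply: ww'; exact: ltnW.
have ww'k j : (j < k)%N -> i j w = i j w' by move=> jk; apply: ww'; exact: ltnW.
by rewrite !(fw_hS fwP) (dx w w')// (dh w w')// (ww' k).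
Qed.

Lemma fw_iterates_in k w :
  @convex_set R 'rV[R]_d Q -> Q x0 -> (forall j, 0 <= gamma j <= 1) ->
  Q (x k w).
Proof.
move=> cQ Qx0 g01; elim: k => [|k IHk]; first by rewrite (fw_x0 fwP).
rewrite (fw_xS fwP); apply: convex_combinationP => //.
by have [] := fw_s fwP k w.
Qed.

(** Brings the update, relative to any reference vector, to the form of
    [Rintegral_resampled_coordinate]. *)
Lemma fw_hS_subE k w (v : 'rV[R]_d) :
  h k.+1 w - v = \row_c (if c == i k w
    then (grad_approx g tau (x k w) - v) 0 c else (h k w - v) 0 c).
Proof.
apply/rowP => c; rewrite (fw_hS fwP) dotp_basis_vec !mxE grad_approxE eqxx /=.
by case: eqVneq => [->|_]; rewrite ?mulr1 ?subrr ?add0r// !mulr0 subr0 addr0.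
Qed.

(** Both iterates stay in [Q] by convexity, and their difference is [gamma k] times a difference of
    two points of [Q]. *)
Lemma fw_grad_drift (f : 'rV[R]_d -> R) (D L : R) k w :
  @convex_set R 'rV[R]_d Q -> Q x0 -> (forall j, 0 <= gamma j <= 1) ->
  0 <= L -> (forall y z, Q y -> Q z -> enorm (y - z) <= D) ->
  lipschitz_grad_on Q f L ->
  enorm (grad f (x k w) - grad f (x k.+1 w)) ^+ 2
    <= L ^+ 2 * D ^+ 2 * gamma k ^+ 2.
Proof.
move=> cQ Qx0 g01 L0 QD fL.
have Qx j : Q (x j w) by exact: fw_iterates_in.
have [Qs _] := fw_s fwP k w.
rewrite -!exprMn ler_sqr ?nnegrE ?sqrtr_ge0//; last first.
  (* The diameter bound at a single point of [Q] gives [D] nonnegative. *)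
  have := QD _ _ Qs Qs; rewrite subrr => D0.
  by rewrite !mulr_ge0 ?(le_trans _ D0) ?sqrtr_ge0//; case/andP: (g01 k).
apply: le_trans (fL _ _ (Qx k) (Qx k.+1)) _.
rewrite -mulrA; apply: ler_wpM2l => //.
rewrite (fw_xS fwP) opprD addNKr -scalerN opprB enormZ mulrC.
have /andP[g0 _] := g01 k; rewrite ger0_norm// ler_wpM2r//.
exact: QD.
Qed.

End jaguar_iterates.

(** * Error recursion in expectation and its solution *)

Theorem theorem1 (R : realType) :
  exists2 C : R, 0 < C &
  forall (d : nat) (Q : set 'rV[R]_d) (D L tau : R)
    (f delta : 'rV[R]_d -> R) (x0 : 'rV[R]_d)
    (disp : measure_display) (T : measurableType disp) (P : probability T R)
    (i : nat -> T -> 'I_d) (x h s : nat -> T -> 'rV[R]_d),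
  (0 < d)%N ->
  compact Q ->
  @convex_set R 'rV[R]_d Q ->
  0 < D ->
  (forall y z, Q y -> Q z -> enorm (y - z) <= D) ->
  (forall y, Q y -> differentiable f y) ->
  0 < L ->
  lipschitz_grad_on Q f L ->
  0 < tau ->
  Q x0 ->
  iid_uniform_indices P i ->
  fw_jaguar Q (noisy f delta) tau (fun k => 4 / (k + 8 * d)%:R) x0 i x h s ->
  forall k : nat,
    ('E_P[fun w => (enorm (h k w - grad f (x k w)) ^+ 2)%R] <=
     C%:E *
     (\big[maxe/-oo]_(j < k.+1)
        'E_P[fun w => (enorm (grad_approx (noisy f delta) tau (x j w)
                              - grad f (x j w)) ^+ 2)%R]
      + (d%:R ^+ 2 * L ^+ 2 * D ^+ 2 / (k + 8 * d)%:R ^+ 2)%R%:E))%E.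
Proof.
exists 192 => // d Q D L tau f delta x0 disp T P i x h s d0 _ cQ _ QD _ L0 fL _
  Qx0 iidP fwP k.
set g := noisy f delta in fwP *.
have g01 j : 0 <= (4 / (j + 8 * d)%:R : R) <= 1.
  rewrite divr_ge0//= ler_pdivrMr ?mul1r ?ler_nat; last first.
    by rewrite ltr0n addn_gt0 muln_gt0 d0 orbT.
  by rewrite (leq_trans _ (leq_addl _ _))// (leq_trans _ (leq_pmulr 8 d0)).
pose err j w : 'rV[R]_d := h j w - grad f (x j w).
pose bias j w : 'rV[R]_d := grad_approx g tau (x j w) - grad f (x j w).
have dx j : depends_on_first i j (x j) := (fw_iterates_depend fwP j).1.
have dh j : depends_on_first i j (h j) := (fw_iterates_depend fwP j).2.
have derr j : depends_on_first i j (err j).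
  by move=> w w' ww'; rewrite /err (dx j w w') ?(dh j w w').
have dbias j : depends_on_first i j (bias j).
  by move=> w w' ww'; rewrite /bias (dx j w w').
have isq j (z : T -> 'rV[R]_d) : depends_on_first i j z ->
    P.-integrable setT (EFin \o (fun w => enorm (z w) ^+ 2)).
  move=> dz; apply: (integrable_depends_on_first iidP (k := j)) => w w' ww'.
  by rewrite (dz w w').
pose hsq j := \int[P]_w (enorm (err j w) ^+ 2).
pose bsq j := \int[P]_w (enorm (bias j w) ^+ 2).
have Esq j (z : T -> 'rV[R]_d) : depends_on_first i j z ->
    'E_P[fun w => (enorm (z w) ^+ 2)%R]%E = (\int[P]_w (enorm (z w) ^+ 2))%:E.
  move=> dz; rewrite unlock /Rintegral fineK//.
  exact: (integrable_fin_num _ (isq j z dz)).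
pose B := L ^+ 2 * D ^+ 2.
have HS j : hsq j.+1 <=
    (1 + (2 * d%:R)^-1) * ((1 - d%:R^-1) * hsq j + d%:R^-1 * bsq j)
    + (1 + 2 * d%:R) * (B * (4 / (j + 8 * d)%:R) ^+ 2).
  (* The new estimate is compared with the old gradient, which is known before draw [j], so the
     resampling identity is exact here. *)
  pose half w : 'rV[R]_d := h j.+1 w - grad f (x j w).
  have dhalf : depends_on_first i j.+1 half.
    move=> w w' ww'; rewrite /half (dh j.+1 w w')// (dx j w w')// => m mj.
    by apply: ww'; exact: ltnW.
  have -> : (1 - d%:R^-1) * hsq j + d%:R^-1 * bsq j =
      \int[P]_w (enorm (half w) ^+ 2).
    rewrite -(Rintegral_resampled_coordinate iidP (derr j) (dbias j)).
    by apply: eq_Rintegral => w _; rewrite /half (fw_hS_subE fwP).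
  have ihalf := isq _ _ dhalf.
  set a := 1 + (2 * d%:R)^-1; set c := (1 + 2 * d%:R) * _.
  have -> : a * \int[P]_w (enorm (half w) ^+ 2) + c =
      \int[P]_w (a * enorm (half w) ^+ 2 + c).
    rewrite RintegralD//; last 2 first.
    - rewrite [X in P.-integrable _ X](_ : _ =
        (fun w => a%:E * (EFin \o (fun w => (enorm (half w) ^+ 2)%R)) w)%E)//.
      exact: integrableZl.
    - exact: finite_measure_integrable_cst.
    rewrite RintegralZl// Rintegral_cst//.
    rewrite (_ : fine _ = 1) ?mulr1//.
    exact: (congr1 fine (probability_setT P)).
  apply: le_Rintegral => //; first exact: isq (derr j.+1).
    apply: (integrable_depends_on_first iidP (k := j.+1)) => w w' ww'.
    by rewrite (dhalf w w').
  move=> w _.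
  have -> : err j.+1 w = half w + (grad f (x j w) - grad f (x j.+1 w)).
    by rewrite /half addrA subrK.
  (* With t = 1/(2d), the drift is multiplied by 1 + 2d. *)
  apply: le_trans (enorm_sqr_addr_le _ _ (t := (2 * d%:R)^-1) _) _.
    by rewrite invr_gt0 mulr_gt0// ltr0n.
  rewrite lerD2l invrK /c ler_wpM2l//.
  exact: (fw_grad_drift fwP _ _ cQ Qx0 g01 (ltW L0) QD fL).
(* [M] bounds the bias at every iterate up to [n], since coordinates of [h n] may have been
   refreshed at any earlier point; it stays fixed during the induction. *)
have bound n (M : R) : (forall j, (j <= n)%N -> bsq j <= M) ->
    hsq n <= 192 * (M + d%:R ^+ 2 * B / (n + 8 * d)%:R ^+ 2).
  have B0 : 0 <= B by rewrite mulr_ge0 ?sqr_ge0.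
  have bsq0 j : 0 <= bsq j by apply: Rintegral_ge0 => w _; exact: sqr_ge0.
  elim: n => [|n IHn] SM; last first.
    apply: le_trans (HS n) _; apply: jaguar_recursion => //.
      by apply: SM.
    by apply: IHn => j jn; apply: SM; exact: leqW.
  (* The full approximation at the start makes the initial error pure bias. *)
  have -> : hsq 0%N = bsq 0%N.
    apply: eq_Rintegral => w _.
    by rewrite /err /bias (fw_h0 fwP) (fw_x0 fwP).
  have := bsq0 0%N; have := SM 0%N (leqnn _).
  have : 0 <= d%:R ^+ 2 * B / (0 + 8 * d)%:R ^+ 2.
    by apply: divr_ge0; [apply: mulr_ge0 => //|]; exact: sqr_ge0.
  lra.
rewrite (Esq k (err k))//.
under eq_bigr => j _ do rewrite (Esq j (bias j))//.
(* An index attaining the largest bias supplies a real [M], below the extended-real maximum of the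
   statement. *)
have [m SM] : exists m : 'I_k.+1, forall j : 'I_k.+1, bsq j <= bsq m.
  case: (arg_maxP (fun j : 'I_k.+1 => bsq j) (erefl : xpredT ord0)) => m _ mP.
  by exists m => j; exact: mP.
have /bound Hk : forall j, (j <= k)%N -> bsq j <= bsq m.
  by move=> j; rewrite -ltnS => jk; exact: (SM (Ordinal jk)).
apply: (@le_trans _ _ (192%:E * ((bsq m)%:E +
    (d%:R ^+ 2 * L ^+ 2 * D ^+ 2 / (k + 8 * d)%:R ^+ 2)%:E))%E).
  by rewrite -EFinD -EFinM lee_fin -[_ * L ^+ 2 * _]mulrA.
apply: lee_wpmul2l; first by rewrite lee_fin.
apply: leeD2r.
exact: (le_bigmax _ (fun j : 'I_k.+1 => (bsq j)%:E)).
Qed.
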